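(* Let $R$ be a $2$-torsion free $\sigma$-prime ring, where $\sigma$ is an involution of $R$, let $U$ be a square closed $\sigma$-Lie ideal of $R$, and let $d$ be a derivation of $R$. Suppose that at least one of the following two conditions holds: (i) $d([x,y])=0$ for all $x,y\in U$; (ii) $[d(x),d(y)]=0$ for all $x,y\in U$ and $d$ commutes with $\sigma$ on $U$. Then $d=0$ or $U\subseteq Z(R)$.
   Context: $R$ is an associative ring (not assumed to have an identity) with center $Z(R)$, and $[x,y]=xy-yx$. An involution $\sigma$ of $R$ is an additive map $\sigma:R\to R$ with $\sigma(xy)=\sigma(y)\sigma(x)$ and $\sigma(\sigma(x))=x$ for all $x,y\in R$. $R$ is $2$-torsion free if $2x=0$ with $x\in R$ implies $x=0$. $R$ is $\sigma$-prime if, for all $a,b\in R$, $aRb=aR\sigma(b)=0$ implies $a=0$ or $b=0$. A derivation of $R$ is an additive map $d:R\to R$ with $d(xy)=d(x)y+xd(y)$ for all $x,y\in R$. A Lie ideal of $R$ is an additive subgroup $U$ of $R$ such that $[u,r]\in U$ for all $u\in U$, $r\in R$; it is a $\sigma$-Lie ideal if moreover $\sigma(U)\subseteq U$, and it is square closed if moreover $u^2\in U$ for all $u\in U$. That $d$ commutes with $\sigma$ on $U$ means $d(\sigma(x))=\sigma(d(x))$ for all $x\in U$. *)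

(* Defs.v *)
From HB Require Import structures.
From mathcomp Require Import all_boot all_algebra.
From mathcomp Require Import boolp classical_sets.

Set Implicit Arguments.
Unset Strict Implicit.
Unset Printing Implicit Defensive.

Import GRing.Theory.
Local Open Scope classical_set_scope.
Local Open Scope ring_scope.

(* Associative rings without a required identity: MathComp's ring structures
   all carry a unit, so the multiplication is that of a semigroup, required to
   distribute over the addition of a zmodType. *)
HB.mixin Record Zmodule_isRng R of GRing.Zmodule R & Semigroup R := {
  rng_mulDl : left_distributive (@monoid.mul R) +%R;
  rng_mulDr : right_distributive (@monoid.mul R) +%R;
}.

#[short(type="rngType")]
HB.structure Definition Rng :=
  {R of Zmodule_isRng R & GRing.Zmodule R & Semigroup R}.

Local Notation "x * y" := (monoid.mul x y) : ring_scope.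

Section RngDefs.
Variable R : rngType.
Implicit Types (sigma d : {additive R -> R}) (U : set R).

Definition lie_bracket (x y : R) : R := x * y - y * x.

Definition center : set R := [set z | forall x, z * x = x * z].

Definition two_torsion_free := forall x : R, x *+ 2 = 0 -> x = 0.

Definition is_involution sigma :=
  (forall x y : R, sigma (x * y) = sigma y * sigma x) /\ involutive sigma.

Definition sigma_prime sigma := forall a b : R,
  (forall x : R, a * x * b = 0) -> (forall x : R, a * x * sigma b = 0) ->
  a = 0 \/ b = 0.

Definition is_derivation d :=
  forall x y : R, d (x * y) = d x * y + x * d y.

Definition is_lie_ideal U :=
  zmod_closed [in U] /\ (forall u r, u \in U -> lie_bracket u r \in U).

Definition is_sigma_lie_ideal sigma U :=
  is_lie_ideal U /\ {in U, forall u, sigma u \in U}.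

Definition square_closed U := {in U, forall u, u * u \in U}.

End RngDefs.

Arguments center : clear implicits.
Arguments two_torsion_free : clear implicits.

(* Main.v *)
Require Import Defs.
From mathcomp Require Import all_boot all_algebra.
From mathcomp Require Import boolp classical_sets.

Set Implicit Arguments.
Unset Strict Implicit.
Unset Printing Implicit Defensive.

Import GRing.Theory.
Local Open Scope classical_set_scope.
Local Open Scope ring_scope.

(** If [U] is not central, it contains a nonzero two-sided ideal [I] stable
    under [sigma], and there the problem becomes one of the kind treated by
    Posner and Herstein.

    The ideal exists because [U] is square closed: then [2xy] lies in [U] for
    all [x, y] in [U], and expanding [[u, vr]] gives [2[u, v]r] in [U], whence
    [2r[u, v]s] in [U] for all [r, s].  So the largest ideal contained in [U] is
    nonzero unless [[U, U] = 0]; in that case [[u, [u, r]] = 0] for all [r], and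
    a classical argument of Herstein makes [U] central
    ([Lie_ideal_core_or_central]).

    A [sigma]-prime ring is semiprime, and in a product [AIB = 0] of two
    sets, one of which is [sigma]-stable, one of the sets is [0]
    ([annihilating_sets]).  Hence the lemma on which everything converges
    ([bracket_annihilates_derivation]): if [[x, z] I d(x) = 0] on [I], then
    linearizing in [x] and using semiprimeness gives [[x, z] I d(w) = 0] for
    independent [x], [z] and [w], so either [d] vanishes on [I], hence
    everywhere, or [I] is commutative, hence so is [R].

    In case (i) the hypothesis of that lemma follows from
    [d([x, yx]) = [x, y]d(x)].  In case (ii), expanding [[d(x), d(yrs)] = 0] gives
    [[d(x), y] I d(d(w)) = 0].  The set of the [[d(x), y]] is [sigma]-stable
    because [d] commutes with [sigma], so one of the two factors vanishes.  If
    [d(d(w)) = 0] on [I], then [2 d(x)d(y) = 0] and [d = 0].  If [d(x)]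
    centralizes [I], then expanding [[d(xx), y]] gives [2 [x, y]d(x) = 0], and the
    lemma applies again. *)

Local Notation "x * y" := (monoid.mul x y) : ring_scope.
Local Notation "[~ x , y ]" := (lie_bracket x y) : ring_scope.

(** * Calculus of brackets *)

Section RngTheory.
Variable R : rngType.
Implicit Types (x y z : R).

Lemma rngA x y z : x * (y * z) = x * y * z.
Proof. exact: mulgA. Qed.

Lemma rng0r x : x * 0 = 0.
Proof. by apply: (addrI (x * 0)); rewrite -rng_mulDr !addr0. Qed.

Lemma rng0l x : 0 * x = 0.
Proof. by apply: (addrI (0 * x)); rewrite -rng_mulDl !addr0. Qed.

Lemma rngNr x y : x * - y = - (x * y).
Proof. by apply: (addrI (x * y)); rewrite -rng_mulDr !subrr rng0r. Qed.

Lemma rngNl x y : - x * y = - (x * y).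
Proof. by apply: (addrI (x * y)); rewrite -rng_mulDl !subrr rng0l. Qed.

Lemma rngBr x y z : x * (y - z) = x * y - x * z.
Proof. by rewrite rng_mulDr rngNr. Qed.

Lemma rngBl x y z : (y - z) * x = y * x - z * x.
Proof. by rewrite rng_mulDl rngNl. Qed.

Lemma rngMn2r x y : x * (y *+ 2) = (x * y) *+ 2.
Proof. by rewrite !mulr2n rng_mulDr. Qed.

Lemma rngMn2l x y : (y *+ 2) * x = (y * x) *+ 2.
Proof. by rewrite !mulr2n rng_mulDl. Qed.

Lemma lieNC x y : [~ x, y] = - [~ y, x].
Proof. by rewrite /lie_bracket opprB. Qed.

Lemma lieDr x y z : [~ x, y + z] = [~ x, y] + [~ x, z].
Proof. by rewrite /lie_bracket rng_mulDl rng_mulDr opprD addrACA. Qed.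

Lemma lieDl x y z : [~ y + z, x] = [~ y, x] + [~ z, x].
Proof. by rewrite /lie_bracket rng_mulDl rng_mulDr opprD addrACA. Qed.

Lemma lieMr x y z : [~ x, y * z] = [~ x, y] * z + y * [~ x, z].
Proof. by rewrite /lie_bracket rngBl rngBr !rngA addrA subrK. Qed.

Lemma lieMl x y z : [~ x * y, z] = x * [~ y, z] + [~ x, z] * y.
Proof. by rewrite /lie_bracket rngBl rngBr !rngA addrA subrK. Qed.

Lemma liexx x : [~ x, x] = 0.
Proof. exact: subrr. Qed.

Lemma lie_eq0 x y : [~ x, y] = 0 -> x * y = y * x.
Proof. by move/eqP; rewrite subr_eq0 => /eqP. Qed.

Lemma lie_eq0C x y : [~ x, y] = 0 -> [~ y, x] = 0.
Proof. by move=> xy0; rewrite lieNC xy0 oppr0. Qed.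

Lemma involution_lie (sigma : {additive R -> R}) x y : is_involution sigma ->
  sigma [~ x, y] = [~ sigma y, sigma x].
Proof. by case=> sM _; rewrite /lie_bracket raddfB !sM. Qed.

End RngTheory.

(** * Ideals of sigma-prime rings *)

Definition sigma_ideal (R : rngType) (sigma : {additive R -> R}) (I : set R) :=
  [/\ forall x y, I x -> I y -> I (x - y), forall r x, I x -> I (r * x),
      forall r x, I x -> I (x * r) & forall x, I x -> I (sigma x)].

Section SigmaPrime.
Variables (R : rngType) (sigma : {additive R -> R}).
Hypotheses (sigma_inv : is_involution sigma) (R_prime : sigma_prime sigma).
Implicit Types (a b x y z : R).

Let sM x y : sigma (x * y) = sigma y * sigma x := sigma_inv.1 x y.
Let sK : involutive sigma := sigma_inv.2.

(** If [aRa = 0], then [a] annihilates both [a x sigma(a)] and its image, so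
    [a x sigma(a) = 0] for all [x], and primeness applies once more. *)
Lemma sigma_prime_semiprime a : (forall x, a * x * a = 0) -> a = 0.
Proof.
move=> aRa; have [//|aNs] : a = 0 \/ forall x, a * x * sigma a = 0.
  case: (pselect (a = 0)) => [|a0]; [by left | right => x].
  have [||//|//] := @R_prime a (a * x * sigma a) => y.
    by rewrite !rngA aRa !rng0l.
  by rewrite !sM sK !rngA aRa !rng0l.
by case: (R_prime aRa aNs).
Qed.

(** Here [[u, [u, rs]] = 2[u, r][u, s]], so that [[u, r] s [u, r] = 0]. *)
Lemma double_bracket_central (R_tf : two_torsion_free R) u :
  (forall r, [~ u, [~ u, r]] = 0) -> center R u.
Proof.
move=> uu; have uruS r s : [~ u, r] * [~ u, s] = 0.
  apply: R_tf; have := uu (r * s).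
  by rewrite lieMr lieDr !lieMr !uu rng0l rng0r add0r addr0 mulr2n.
move=> r; apply: lie_eq0; apply: sigma_prime_semiprime => s.
have := uruS r (s * r).
by rewrite lieMr rng_mulDr !rngA uruS rng0l add0r.
Qed.

Section Ideal.
Variable I : set R.
Hypotheses (I_ideal : sigma_ideal sigma I) (I_neq0 : exists2 x, I x & x <> 0).

Let IB x y : I x -> I y -> I (x - y).
Proof. by case: I_ideal => + _ _ _; apply. Qed.
Let IN x : I x -> I (- x).
Proof. by move=> Ix; rewrite -sub0r -(subrr x); apply: IB (IB _ _) _. Qed.
Let ID x y : I x -> I y -> I (x + y).
Proof. by move=> Ix Iy; rewrite -[y]opprK; apply: IB; rewrite //; apply: IN. Qed.
Let IMl r x : I x -> I (r * x). Proof. by case: I_ideal => _ + _ _; apply. Qed.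
Let IMr r x : I x -> I (x * r). Proof. by case: I_ideal => _ _ + _; apply. Qed.
Let Is x : I x -> I (sigma x). Proof. by case: I_ideal => _ _ _; apply. Qed.

Lemma ideal_faithfull a : (forall i, I i -> a * i = 0) -> a = 0.
Proof.
move=> aI; have [i Ii i0] := I_neq0.
have [||//|//] := @R_prime a i => r; rewrite -rngA aI //; apply: IMl => //.
exact: Is.
Qed.

Lemma ideal_faithfulr a : (forall i, I i -> i * a = 0) -> a = 0.
Proof.
move=> Ia; rewrite -[a]sK; suff -> : sigma a = 0 by rewrite raddf0.
apply: ideal_faithfull => i Ii; rewrite -[i]sK -sM Ia ?raddf0 //; exact: Is.
Qed.

Lemma ideal_semiprime a : (forall i, I i -> a * i * a = 0) -> a = 0.
Proof.
move=> aIa; apply: ideal_faithfull => i Ii.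
apply: sigma_prime_semiprime => r; rewrite rngA -[a * i * r]rngA aIa ?rng0l //.
exact: IMr.
Qed.

Lemma ideal_annihilC a b : (forall i, I i -> a * i * b = 0) ->
  forall i, I i -> b * i * a = 0.
Proof.
move=> aIb i Ii; apply: ideal_semiprime => j Ij.
have -> : b * i * a * j * (b * i * a) = b * i * (a * j * b) * (i * a).
  by rewrite !rngA.
by rewrite aIb // rng0r rng0l.
Qed.

Lemma ideal_prime a b : (forall i, I i -> a * i * b = 0) ->
  (forall i, I i -> a * i * sigma b = 0) -> a = 0 \/ b = 0.
Proof.
move=> aIb aIsb; case: (pselect (b = 0)) => [|b0]; [by right | left].
apply: ideal_faithfull => i Ii.
by have [||//|//] := @R_prime (a * i) b => r;
  rewrite -[a * i * r]rngA ?aIb ?aIsb //; apply: IMr.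
Qed.

(** If some [b] in [B] is nonzero, every [a] in [A] satisfies
    [sigma(b) I a = sigma(b) I sigma(a) = 0], so the stability of one of the two
    sets is enough. *)
Lemma annihilating_sets (A B : set R) :
  (forall a, A a -> A (sigma a)) ->
  (forall a b i, A a -> B b -> I i -> a * i * b = 0) ->
  (forall a, A a -> a = 0) \/ (forall b, B b -> b = 0).
Proof.
move=> As AIB; case: (pselect (forall b, B b -> b = 0)) => [|/existsNP[b]].
  by right.
move=> /not_implyP[Bb b0]; left=> a Aa.
have [||sb0|//] := @ideal_prime (sigma b) a => [i Ii|i Ii|].
- rewrite -[i]sK -[a]sK -!sM rngA AIB ?raddf0 //; [exact: As | exact: Is].
- rewrite -[i]sK -!sM rngA AIB ?raddf0 //; exact: Is.
- by case: b0; rewrite -[b]sK sb0 raddf0.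
Qed.

Lemma centralizer_ideal c : (forall y, I y -> [~ c, y] = 0) ->
  forall r, [~ c, r] = 0.
Proof.
move=> cI r; apply: ideal_faithfulr => y Iy.
have := cI (y * r) (IMr r Iy).
by rewrite lieMr cI // rng0l add0r.
Qed.

Lemma commutative_ideal : (forall x y, I x -> I y -> [~ x, y] = 0) ->
  forall r s : R, [~ r, s] = 0.
Proof.
move=> II r; apply: centralizer_ideal => x Ix; apply: lie_eq0C.
by apply: centralizer_ideal => y Iy; apply: II.
Qed.

(** * Derivations on a sigma-ideal *)

Variable d : {additive R -> R}.
Hypothesis d_der : is_derivation d.

Lemma derivation_eq0_on_ideal : (forall x, I x -> d x = 0) -> forall x, d x = 0.
Proof.
move=> dI r; apply: ideal_faithfull => x Ix.
have := dI _ (IMl r Ix).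
by rewrite d_der (dI x) // rng0r addr0.
Qed.

(** Linearizing in [x] gives [[x, z] y d(w) = - [w, z] y d(x)]; hence
    [[x, z] y d(w)] times [I] times itself contains a factor in
    [d(w) I [w, z] = 0], so it vanishes by semiprimeness. *)
Lemma bracket_annihilates_derivation :
  (forall x y z, I x -> I y -> I z -> [~ x, z] * y * d x = 0) ->
  (forall x, d x = 0) \/ (forall r s : R, [~ r, s] = 0).
Proof.
move=> xId.
have lin x y z w : I x -> I y -> I z -> I w ->
    [~ x, z] * y * d w = - ([~ w, z] * y * d x).
  move=> Ix Iy Iz Iw; apply/eqP; rewrite -addr_eq0.
  have := xId (x + w) y z (ID Ix Iw) Iy Iz.
  rewrite lieDl raddfD 2!rng_mulDl 2!rng_mulDr !xId // add0r addr0.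
  by move->.
have xIw x y z w : I x -> I y -> I z -> I w -> [~ x, z] * y * d w = 0.
  move=> Ix Iy Iz Iw; apply: ideal_semiprime => t It.
  rewrite {2}lin // rngNr.
  have -> : [~ x, z] * y * d w * t * ([~ w, z] * y * d x) =
      [~ x, z] * y * (d w * t * [~ w, z]) * (y * d x) by rewrite !rngA.
  rewrite (@ideal_annihilC [~ w, z] (d w)) ?rng0r ?rng0l ?oppr0 // => i Ii.
  exact: xId.
have [|||dI] := @annihilating_sets
    [set a | exists x z, [/\ I x, I z & a = [~ x, z]]] [set d w | w in I].
- move=> _ [x [z [Ix Iz ->]]]; exists (sigma z), (sigma x).
  by split; [exact: Is | exact: Is | rewrite involution_lie].
- by move=> _ _ i [x [z [Ix Iz ->]]] [w Iw <-] Ii; apply: xIw.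
- move=> II; right; apply: commutative_ideal => x z Ix Iz.
  by apply: II; exists x, z.
- by left; apply: derivation_eq0_on_ideal => x Ix; apply: dI; exists x.
Qed.

(** From [[x, yx] = [x, y]x] one gets [[x, y] d(x) = 0], and [y := zy] turns this
    into [[x, z] y d(x) = 0]. *)
Lemma derivation_kills_brackets :
  (forall x y, I x -> I y -> d [~ x, y] = 0) ->
  (forall x, d x = 0) \/ (forall r s : R, [~ r, s] = 0).
Proof.
move=> dII.
have xy_dx x y : I x -> I y -> [~ x, y] * d x = 0.
  move=> Ix Iy; have := dII x (y * x) Ix (IMl y Ix).
  by rewrite lieMr liexx rng0r addr0 d_der dII // rng0l add0r.
apply: bracket_annihilates_derivation => x y z Ix Iy Iz.
have := xy_dx x (z * y) Ix (IMr y Iz).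
by rewrite lieMr rng_mulDl -[z * _ * _]rngA xy_dx // rng0r addr0.
Qed.

Section TwoTorsionFree.
Hypothesis R_tf : two_torsion_free R.

(** [d(d(xy)) = 2 d(x) d(y)] when [d(d(I)) = 0], and [d(x)d(ry) = 0] then
    becomes [d(x) r d(y) = 0]. *)
Lemma derivation_square_eq0 : (forall x, I x -> d (d x) = 0) ->
  forall x, d x = 0.
Proof.
move=> ddI; have dxdy x y : I x -> I y -> d x * d y = 0.
  move=> Ix Iy; apply: R_tf; have := ddI _ (IMl x Iy).
  by rewrite d_der raddfD !d_der !ddI // rng0l rng0r add0r addr0 mulr2n.
apply: derivation_eq0_on_ideal => x Ix; apply: ideal_semiprime => r Ir.
have := dxdy x (r * x) Ix (IMl r Ix).
by rewrite d_der rng_mulDr !rngA dxdy // rng0l add0r.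
Qed.

(** On [I] the values of [d] are then central in [R], and [[d(xx), y] = 0]
    reduces to [2 [x, y] d(x) = 0]; centrality of [d(x)] inserts the middle
    factor of [bracket_annihilates_derivation]. *)
Lemma derivation_centralizes :
  (forall x y, I x -> I y -> [~ d x, y] = 0) ->
  (forall x, d x = 0) \/ (forall r s : R, [~ r, s] = 0).
Proof.
move=> dII.
have dx_central x r : I x -> [~ d x, r] = 0.
  by move=> Ix; apply: centralizer_ideal => y; apply: dII.
have dxC x r : I x -> d x * r = r * d x.
  by move=> Ix; apply: lie_eq0; apply: dx_central.
have xy_dx x y : I x -> I y -> [~ x, y] * d x = 0.
  move=> Ix Iy; apply: R_tf; have := dII (x * x) y (IMl x Ix) Iy.
  rewrite d_der dxC // lieDl !lieMl !dx_central // !rng0r !add0r.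
  by rewrite mulr2n.
apply: bracket_annihilates_derivation => x y z Ix Iy Iz.
by rewrite -rngA -dxC // rngA xy_dx // rng0l.
Qed.

(** The term [[d(x), d(y)]] of the expansion of [[d(x), d(yr)]] vanishes; replacing
    [r] by [rs] then gives [d(y) r [d(x), s] + [d(x), y] r d(s) = 0], and
    [s = d(w)] kills the first summand.  The set of the [[d(x), y]] is
    [sigma]-stable since [sigma [d(x), y] = [d(- sigma x), sigma y]]. *)
Lemma derivation_commuting_values :
  (forall x, I x -> d (sigma x) = sigma (d x)) ->
  (forall x y, I x -> I y -> [~ d x, d y] = 0) ->
  (forall x, d x = 0) \/ (forall r s : R, [~ r, s] = 0).
Proof.
move=> ds dd.
have expand x y r : I x -> I y -> I r ->
    d y * [~ d x, r] + [~ d x, y] * d r = 0.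
  move=> Ix Iy Ir; have := dd x (y * r) Ix (IMl y Ir).
  by rewrite d_der lieDr !lieMr !dd // rng0l rng0r add0r addr0.
have expandR x y r s : I x -> I y -> I r ->
    d y * r * [~ d x, s] + [~ d x, y] * r * d s = 0.
  move=> Ix Iy Ir; have := expand x y (r * s) Ix Iy (IMr s Ir).
  rewrite d_der lieMr !rng_mulDr !rngA addrACA.
  by rewrite -rng_mulDl expand // rng0l add0r.
have [|||dd0] := @annihilating_sets
    [set a | exists x y, [/\ I x, I y & a = [~ d x, y]]]
    [set d (d w) | w in I].
- move=> _ [x [y [Ix Iy ->]]]; exists (- sigma x), (sigma y).
  split; [exact/IN/Is | exact: Is | rewrite involution_lie // lieNC].
  by rewrite raddfN ds // /lie_bracket rngNl rngNr opprB opprK addrC.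
- move=> _ _ i [x [y [Ix Iy ->]]] [w Iw <-] Ii.
  by have := expandR x y i (d w) Ix Iy Ii; rewrite dd // rng0r add0r.
- move=> dII; apply: derivation_centralizes => x y Ix Iy.
  by apply: dII; exists x, y.
- by left; apply: derivation_square_eq0 => x Ix; apply: dd0; exists x.
Qed.

End TwoTorsionFree.
End Ideal.

(** * The ideal inside a square closed Lie ideal *)

(** The largest two-sided ideal contained in [U], when [U] is an additive
    subgroup; without a unit, the four kinds of multiples are independent. *)
Definition ideal_core (U : set R) : set R :=
  [set x | [/\ U x, forall r, U (r * x), forall r, U (x * r)
             & forall r s, U (r * x * s)]].

Section LieIdeal.
Variable U : set R.
Hypothesis U_lie : is_sigma_lie_ideal sigma U.

Let U0 : U 0. Proof. by case: U_lie.1.1 => /set_mem. Qed.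
Let UB x y : U x -> U y -> U (x - y).
Proof. by move=> Ux Uy; apply/set_mem/U_lie.1.1.2; apply/mem_set. Qed.
Let UN x : U x -> U (- x).
Proof. by move=> Ux; rewrite -sub0r; apply: UB. Qed.
Let UD x y : U x -> U y -> U (x + y).
Proof. by move=> Ux Uy; rewrite -[y]opprK; apply/UB/UN. Qed.
Let Ulie u r : U u -> U [~ u, r].
Proof. by move=> Uu; apply/set_mem/U_lie.1.2/mem_set. Qed.
Let Us u : U u -> U (sigma u).
Proof. by move=> Uu; apply/set_mem/U_lie.2/mem_set. Qed.

Lemma ideal_core_sigma_ideal : sigma_ideal sigma (ideal_core U).
Proof.
split=> [x y [Ux lx rx bx] [Uy ly ry by_]|r x [Ux lx rx bx]|r x [Ux lx rx bx]|].
- by split=> [|r|r|r s]; rewrite ?(rngBl, rngBr) ?rngBl; apply: UB.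
- by split=> [|s|s|s t]; rewrite ?rngA.
- by split=> [|s|s|s t]; rewrite ?rngA -?[x * r * _]rngA -?[_ * x * r * _]rngA.
- move=> x [Ux lx rx bx].
  by split=> [|r|r|r s]; [|rewrite -[r]sK -sM..|rewrite -[r]sK -[s]sK -!sM rngA];
    apply: Us.
Qed.

Hypothesis U_sq : square_closed U.

(** [2xy] is the sum of [xy + yx = (x + y)^2 - x^2 - y^2] and [xy - yx]. *)
Lemma square_closed_double_mul x y : U x -> U y -> U ((x * y) *+ 2).
Proof.
have sq z : U z -> U (z * z) by move=> Uz; apply/set_mem/U_sq/mem_set.
move=> Ux Uy; have -> : (x * y) *+ 2 =
    (x + y) * (x + y) - x * x - y * y + [~ x, y].
  rewrite /lie_bracket rng_mulDl !rng_mulDr.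
  have -> : x * x + x * y + (y * x + y * y) = x * y + y * x + y * y + x * x.
    by rewrite [x * x + _]addrC addrAC addrA.
  by rewrite 2!addrK addrACA subrr addr0 mulr2n.
by apply: UD; [apply: UB; [apply: UB|]|]; auto.
Qed.

(** With [c = [u, v]]: [2ct = 2[u, vt] - 2v[u, t]] lies in [U], the last term by
    square closure; then so does [2tcw = 2cwt - [2cw, t]]. *)
Lemma lie_core u v r s : U u -> U v -> ideal_core U ((r * [~ u, v] * s) *+ 2).
Proof.
move=> Uu Uv; set c := [~ u, v].
have U2 x : U x -> U (x *+ 2) by move=> Ux; rewrite mulr2n; apply: UD.
have cr t : U ((c * t) *+ 2).
  rewrite (_ : c * t = [~ u, v * t] - v * [~ u, t]); last first.
    by rewrite lieMr addrK.
  rewrite mulrnBl; apply: UB; first exact/U2/Ulie.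
  by apply: square_closed_double_mul => //; apply: Ulie.
have rcs t w : U ((t * c * w) *+ 2).
  rewrite (_ : t * c * w = c * w * t - [~ c * w, t]); last first.
    by rewrite /lie_bracket opprB addrC rngA subrK.
  rewrite mulrnBl; apply: UB; first by rewrite -rngA.
  by rewrite mulr2n -lieDl -mulr2n; apply: Ulie.
split=> [|x|x|x y]; rewrite ?rngMn2l ?rngMn2r ?rngMn2l ?rngA //.
- by rewrite -[r * c * s * x]rngA.
- by rewrite -[x * r * c * s * y]rngA.
Qed.

Lemma Lie_ideal_core_or_central : two_torsion_free R ->
  U `<=` center R \/ exists2 x, ideal_core U x & x <> 0.
Proof.
move=> R_tf.
case: (pselect (exists2 x, ideal_core U x & x <> 0)) => [|none]; first by right.
have core0 x : ideal_core U x -> x = 0.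
  by move=> Cx; apply: contrapT => x0; apply: none; exists x.
left=> u Uu; apply: double_bracket_central => // r.
set c := [~ u, _]; have RcR t s : t * c * s = 0.
  by apply: R_tf; apply: core0; apply: lie_core => //; apply: Ulie.
(* Semiprimeness is used twice: for c, then for c s c, whose products with
   itself contain R c R. *)
apply: sigma_prime_semiprime => s; apply: sigma_prime_semiprime => t.
by rewrite -!rngA rngA rngA RcR.
Qed.

End LieIdeal.
End SigmaPrime.

Theorem theorem3 (R : rngType) (sigma d : {additive R -> R}) (U : set R)
  (R_tf : two_torsion_free R)
  (sigma_inv : is_involution sigma)
  (R_prime : sigma_prime sigma)
  (U_lie : is_sigma_lie_ideal sigma U)
  (U_sq : square_closed U)
  (d_der : is_derivation d)
  (d_cond :
     {in U &, forall x y : R, d (lie_bracket x y) = 0}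
     \/ ({in U &, forall x y : R, lie_bracket (d x) (d y) = 0}
         /\ {in U, forall x : R, d (sigma x) = sigma (d x)})) :
  (forall x : R, d x = 0) \/ U `<=` center R.
Proof.
have [|core_neq0] := Lie_ideal_core_or_central sigma_inv R_prime U_lie U_sq R_tf.
  by right.
have core_ideal := ideal_core_sigma_ideal sigma_inv U_lie.
have coreU x : ideal_core U x -> x \in U by case=> Ux _ _ _; apply/mem_set.
suff [] : (forall x, d x = 0) \/ (forall r s : R, [~ r, s] = 0).
- by left.
- by move=> RC; right=> u _ r; apply: lie_eq0.
case: d_cond => [dU|[ddU dsU]].
  apply: (derivation_kills_brackets sigma_inv R_prime core_ideal) => // x y Ix Iy.
  by apply: dU; apply: coreU.
apply: (derivation_commuting_values sigma_inv R_prime core_ideal) => //.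
  by move=> x /coreU; apply: dsU.
by move=> x y /coreU Ux /coreU Uy; apply: ddU.
Qed.
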